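(* Let $n\ge 2$, let $K$ be a field, and let $A$ be a total associative $n$-algebra over $K$ with $n$-multiplication $(a_1,\ldots,a_n)$. Suppose that $n$ is even, or that $\operatorname{char} K=p>0$ and $n$ is divisible by $p$. Then the Lie $n$-commutator algebra $[A]$ is homotopical $n$-Lie; that is, for all $a_1,\ldots,a_{2n-1}\in A$, $$\sum_{\sigma\in S_{n-1,n}} \operatorname{sign}(\sigma)\,\bigl[a_{\sigma(1)},\ldots,a_{\sigma(n-1)},[a_{\sigma(n)},\ldots,a_{\sigma(2n-1)}]\bigr]=0 .$$
   Context: An $n$-algebra over $K$ is a $K$-vector space $A$ with a multilinear map $A\times\cdots\times A\to A$ of $n$ arguments, $(a_1,\ldots,a_n)\mapsto(a_1,\ldots,a_n)$ (the $n$-multiplication). It is total associative if $$(a_1,\ldots,a_i,(a_{i+1},\ldots,a_{i+n}),a_{i+n+1},\ldots,a_{2n-1})=(a_1,\ldots,a_{i+1},(a_{i+2},\ldots,a_{i+n+1}),a_{i+n+2},\ldots,a_{2n-1})$$ for all $0\le i\le n-2$ and all $a_1,\ldots,a_{2n-1}\in A$. $Sym_m$ is the group of permutations of $\{1,\ldots,m\}$. The algebra $[A]$ is the vector space $A$ with the $n$-multiplication (Lie $n$-commutator) $$[a_1,\ldots,a_n]=\sum_{\sigma\in Sym_n}\operatorname{sign}(\sigma)\,(a_{\sigma(1)},\ldots,a_{\sigma(n)}).$$ $S_{n-1,n}=\{\sigma\in Sym_{2n-1} : \sigma(1)<\cdots<\sigma(n-1),\ \sigma(n)<\cdots<\sigma(2n-1)\}$.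 An $n$-algebra $(B,\omega)$ is homotopical $n$-Lie if $\sum_{\sigma\in S_{n-1,n}}\operatorname{sign}(\sigma)\,\omega(b_{\sigma(1)},\ldots,b_{\sigma(n-1)},\omega(b_{\sigma(n)},\ldots,b_{\sigma(2n-1)}))=0$ for all $b_1,\ldots,b_{2n-1}\in B$. *)

(* Defs.v *)
From HB Require Import structures.
From mathcomp Require Import all_boot all_order all_fingroup all_algebra.

Set Implicit Arguments.
Unset Strict Implicit.
Unset Printing Implicit Defensive.

Import GRing.Theory.
Local Open Scope ring_scope.

Definition tuple_set (T : Type) (n : nat) (a : n.-tuple T) (i : 'I_n) (x : T) :
    n.-tuple T :=
  [tuple if j == i then x else tnth a j | j < n].

Definition tuple_perm (T : Type) (n : nat) (a : n.-tuple T) (s : 'S_n) :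
    n.-tuple T :=
  [tuple tnth a (s j) | j < n].

Definition multilinear (K : fieldType) (V : lmodType K) (n : nat)
    (w : n.-tuple V -> V) : Prop :=
  forall (a : n.-tuple V) (i : 'I_n), linear (fun x : V => w (tuple_set a i x)).

Record nAlgebra (K : fieldType) (n : nat) := NAlgebra {
  carrier :> lmodType K;
  nmul : n.-tuple carrier -> carrier;
  nmul_multilinear : multilinear nmul
}.

(* (a_1, ..., a_i, (a_{i+1}, ..., a_{i+n}), a_{i+n+1}, ..., a_{2n-1}) for
   i < n; tuples are indexed from 0, so a_k is a`_k.-1.  The default value of
   nth is never reached when i < n. *)
Definition nest (K : fieldType) (V : lmodType K) (n : nat)
    (w : n.-tuple V -> V) (i : nat) (a : (2 * n - 1).-tuple V) : V :=
  w [tuple if (k < i)%N then a`_k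
           else if k == i :> nat then w [tuple a`_(i + j) | j < n]
           else a`_(k + n - 1) | k < n].

Definition total_associative (K : fieldType) (n : nat) (A : nAlgebra K n) :
    Prop :=
  forall (i : nat) (a : (2 * n - 1).-tuple A), (i <= n - 2)%N ->
    nest (@nmul K n A) i a = nest (@nmul K n A) i.+1 a.

Definition ncommutator (K : fieldType) (n : nat) (A : nAlgebra K n)
    (a : n.-tuple A) : A :=
  \sum_(s : 'S_n) (-1) ^+ s *: nmul (tuple_perm a s).

Lemma tuple_perm_set (T : Type) (n : nat) (a : n.-tuple T) (s : 'S_n)
    (i : 'I_n) (x : T) :
  tuple_perm (tuple_set a i x) s = tuple_set (tuple_perm a s) ((s^-1)%g i) x.
Proof.
apply: eq_from_tnth => j; rewrite !tnth_mktuple.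
by rewrite (canF_eq (permK s)).
Qed.

Lemma ncommutator_multilinear (K : fieldType) (n : nat) (A : nAlgebra K n) :
  multilinear (@ncommutator K n A).
Proof.
move=> a i c x y; rewrite /ncommutator scaler_sumr -big_split /=.
apply: eq_bigr => s _; rewrite !tuple_perm_set nmul_multilinear.
by rewrite scalerDr !scalerA mulrC.
Qed.

Definition commutator_algebra (K : fieldType) (n : nat) (A : nAlgebra K n) :
    nAlgebra K n :=
  NAlgebra (@ncommutator_multilinear K n A).

(* S_{n-1,n}; since indices start at 0, the blocks are {0, ..., n - 2} and
   {n - 1, ..., 2n - 2}. *)
Definition shuffles (n : nat) : {set 'S_(2 * n - 1)} :=
  [set s : 'S_(2 * n - 1) |
    [forall i : 'I_(2 * n - 1), forall j : 'I_(2 * n - 1),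
       (i < j < n - 1)%N || (n - 1 <= i < j)%N ==> (s i < s j)%N]].

Definition homotopical_nLie (K : fieldType) (n : nat) (B : nAlgebra K n) :
    Prop :=
  forall b : (2 * n - 1).-tuple B,
    \sum_(s in shuffles n)
      (-1) ^+ s *: nest (@nmul K n B) (n - 1) (tuple_perm b s) = 0.

(* Main.v *)
(* Expand the double commutator.  A word in the a_k arises once for each position
   i of the inner product, and by total associativity its value does not depend
   on i; moving the inner block (n letters outside, one letter inside the outer
   product) past n - 1 - i letters gives it the sign
   sign(w) (-1)^((n + 1) (n - 1 - i)).  The sum is therefore
   (\sum_(i < n) (-1)^((n + 1) (n - 1 - i))) \sum_w sign(w) w, and the first
   factor is an alternating sum of n terms when n is even and equals n when n is
   odd. *)
Require Import Defs.
From HB Require Import structures.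
From mathcomp Require Import all_boot all_order all_fingroup all_algebra.
From mathcomp Require Import zify.

Set Implicit Arguments.
Unset Strict Implicit.
Unset Printing Implicit Defensive.

Import GRing.Theory.
Local Open Scope ring_scope.

(** * Shuffles as coset representatives of a Young subgroup *)

Definition block_shuffles (p m : nat) : {set 'S_m} :=
  [set s : 'S_m |
    [forall i : 'I_m, forall j : 'I_m,
       (i < j < p)%N || (p <= i < j)%N ==> (s i < s j)%N]].

Lemma block_shufflesP (p m : nat) (s : 'S_m) :
  reflect (forall i j : 'I_m, (i < j < p)%N || (p <= i < j)%N -> (s i < s j)%N)
          (s \in block_shuffles p m).
Proof.
rewrite inE; apply: (iffP forallP) => [h i j ij|h i].
  by have /forallP/(_ j)/implyP := h i; apply.
by apply/forallP => j; apply/implyP; apply: h.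
Qed.

(** An increasing permutation never moves a point down; applied to [t] and to its inverse, this
    forces equality. *)
Lemma increasing_perm1 (p : nat) (t : 'S_p) :
  (forall i j : 'I_p, (i < j)%N -> (t i < t j)%N) -> t = 1%g.
Proof.
have ge_id (u : 'S_p) :
    (forall i j : 'I_p, (i < j)%N -> (u i < u j)%N) -> forall i : 'I_p, (i <= u i)%N.
  move=> u_incr [i lt_ip]; elim: i lt_ip => [|i IHi] // lt_ip.
  have := IHi (ltnW lt_ip) => /= /leq_ltn_trans; apply.
  exact: u_incr.
move=> t_incr; apply/permP => i; rewrite perm1; apply/val_inj/eqP.
rewrite eqn_leq ge_id // andbT -{2}(permK t i) ge_id // => {i} i j lt_ij.
have := t_incr ((t^-1)%g j) ((t^-1)%g i); rewrite !permKV.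
case: (ltngtP ((t^-1)%g i) ((t^-1)%g j)) => //.
  by move=> _ /(_ isT); lia.
by move=> /val_inj/perm_inj eq_ij; rewrite eq_ij ltnn in lt_ij.
Qed.

Section BlockPerm.
Variables p q : nat.

Definition block_perm_fun (t : 'S_p) (r : 'S_q) (k : 'I_(p + q)) :=
  match split k with inl i => lshift q (t i) | inr j => rshift p (r j) end.

Fact block_perm_fun_inj t r : injective (block_perm_fun t r).
Proof.
move=> x y; rewrite /block_perm_fun.
case: (splitP x) => i xi; case: (splitP y) => j yj /(congr1 val) /=.
- by move=> /val_inj/perm_inj eq_ij; apply: val_inj; rewrite /= xi yj eq_ij.
- by have := ltn_ord (t i); lia.
- by have := ltn_ord (t j); lia.
- by move/addnI/val_inj/perm_inj => eq_ij; apply: val_inj; rewrite /= xi yj eq_ij.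
Qed.

(** These permutations form the Young subgroup of type (p, q). *)
Definition block_perm t r : 'S_(p + q) := perm (@block_perm_fun_inj t r).

Lemma block_perml t r i : block_perm t r (lshift q i) = lshift q (t i).
Proof. by rewrite permE /block_perm_fun (unsplitK (inl i)). Qed.

Lemma block_permr t r j : block_perm t r (rshift p j) = rshift p (r j).
Proof. by rewrite permE /block_perm_fun (unsplitK (inr j)). Qed.

Lemma block_permM t1 t2 r1 r2 :
  block_perm (t1 * t2) (r1 * r2) = (block_perm t1 r1 * block_perm t2 r2)%g.
Proof.
apply/permP => k; rewrite permM; case: (split_ordP k) => j ->.
  by rewrite !block_perml permM.
by rewrite !block_permr permM.
Qed.

Lemma block_perm1 : block_perm 1 1 = 1%g.
Proof.
apply/permP => k; rewrite perm1; case: (split_ordP k) => j ->.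
  by rewrite block_perml perm1.
by rewrite block_permr perm1.
Qed.

Lemma block_permV t r : (block_perm t r)^-1%g = block_perm t^-1 r^-1.
Proof.
by apply/eqP; rewrite eq_invg_mul -block_permM !mulgV block_perm1.
Qed.

(** Signs are determinants of permutation matrices, and here the matrix is block diagonal. *)
Lemma sign_block_perm (R : comUnitRingType) t r :
  (-1) ^+ block_perm t r = (-1) ^+ t * (-1) ^+ r :> R.
Proof.
rewrite -!det_perm -(det_ublock _ 0); congr (\det _); apply/matrixP => i j.
rewrite !mxE; case: (split_ordP i) => i' ->; rewrite ?block_perml ?block_permr;
  rewrite ?(unsplitK (inl _)) ?(unsplitK (inr _)) !mxE; case: (split_ordP j) => j' ->;
  by rewrite !mxE ?eq_lshift ?eq_rshift ?eq_lrshift ?eq_rlshift.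
Qed.

End BlockPerm.

Definition moment (m : nat) (s : 'S_m) : nat := (\sum_(k < m) k * s k)%N.

(** Rearrangement inequality: undoing the inversion adds [(j - i) * (s i - s j)] to the moment. *)
Lemma moment_tperm (m : nat) (s : 'S_m) (i j : 'I_m) :
  (i < j)%N -> (s j < s i)%N -> (moment s < moment (tperm i j * s)%g)%N.
Proof.
move=> lt_ij lt_s; rewrite /moment.
have neq_ji : j != i by apply/eqP => e; rewrite e ltnn in lt_ij.
rewrite (bigD1 i) // (bigD1 j neq_ji) /= [ltnRHS](bigD1 i) // (bigD1 j neq_ji) /=.
rewrite !permM tpermL tpermR.
rewrite [X in (_ < _ + (_ + X))%N](eq_bigr (fun k : 'I_m => k * s k)%N); first by nia.
by move=> k /andP[neq_ki neq_kj]; rewrite permM tpermD // eq_sym.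
Qed.

(* The shuffle in a coset of the Young subgroup is the element of maximal moment. *)
Lemma block_shuffle_exists (p q : nat) (w : 'S_(p + q)) :
  exists t r, (block_perm t r * w)%g \in block_shuffles p (p + q).
Proof.
pose f (tr : 'S_p * 'S_q) := moment (block_perm tr.1 tr.2 * w)%g.
have [[t r] _ /= max_tr] := @arg_maxnP _ (1, 1)%g xpredT f isT.
exists t, r; set s := (_ * w)%g.
have max_s t' r' : (moment (block_perm t' r' * s)%g <= moment s)%N.
  by have := max_tr (t' * t, r' * r)%g isT; rewrite /f /= block_permM -mulgA.
apply/block_shufflesP => i j ij; rewrite ltnNge; apply/negP.
rewrite leq_eqVlt => /orP[/eqP/ord_inj/perm_inj|lt_s].
  by move=> eij; rewrite eij ltnn ?andbF in ij.
have lt_ij : (i < j)%N by lia.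
have := moment_tperm lt_ij lt_s.
(* As [i] and [j] lie in one block, their transposition is in the Young subgroup, which contradicts
   maximality. *)
suff [t' [r' ->]] : exists t' r', tperm i j = block_perm t' r'.
  by rewrite ltnNge max_s.
case: (split_ordP i) (split_ordP j) ij lt_ij {lt_s} => i' -> [] j' -> /=.
- move=> _ _; exists (tperm i' j'), 1%g; apply/permP => k.
  case: (split_ordP k) => k' ->; rewrite ?block_perml ?block_permr ?perm1.
    by rewrite (inj_tperm _ _ _ (@lshift_inj p q)).
  by rewrite tpermD ?eq_lrshift.
- by have := ltn_ord i'; lia.
- by have := ltn_ord j'; lia.
- move=> _ _; exists 1%g, (tperm i' j'); apply/permP => k.
  case: (split_ordP k) => k' ->; rewrite ?block_perml ?block_permr ?perm1.
    by rewrite tpermD ?eq_rlshift.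
  by rewrite (inj_tperm _ _ _ (@rshift_inj p q)).
Qed.

(** Since [s] increases on each block, any pair reversed by [t] or [r] would stay reversed in the
    product; so both are increasing. *)
Lemma block_shuffle_unique (p q : nat) (t : 'S_p) (r : 'S_q) (s : 'S_(p + q)) :
    s \in block_shuffles p (p + q) ->
    (block_perm t r * s)%g \in block_shuffles p (p + q) ->
  t = 1%g /\ r = 1%g.
Proof.
move=> /block_shufflesP s_sh /block_shufflesP ts_sh; split.
  apply: increasing_perm1 => i j lt_ij.
  have := ts_sh (lshift q i) (lshift q j); rewrite !permM !block_perml /= ltn_ord lt_ij.
  move=> /(_ isT); apply: contraLR; rewrite -!leqNgt leq_eqVlt.
  case/predU1P => [/ord_inj/perm_inj e|lt_t]; first by rewrite e ltnn in lt_ij.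
  by have := s_sh (lshift q (t j)) (lshift q (t i)); rewrite /= lt_t ltn_ord => /(_ isT)/ltnW.
apply: increasing_perm1 => i j lt_ij.
have := ts_sh (rshift p i) (rshift p j); rewrite !permM !block_permr /=.
rewrite leq_addr ltn_add2l lt_ij orbT.
move=> /(_ isT); apply: contraLR; rewrite -!leqNgt leq_eqVlt.
case/predU1P => [/ord_inj/perm_inj e|lt_t]; first by rewrite e ltnn in lt_ij.
have := s_sh (rshift p (r j)) (rshift p (r i)); rewrite /= leq_addr ltn_add2l lt_t orbT.
by move=> /(_ isT)/ltnW.
Qed.

Lemma sum_block_shuffles (V : nmodType) (p q : nat) (F : 'S_(p + q) -> V) :
  \sum_w F w =
  \sum_(s in block_shuffles p (p + q)) \sum_(t : 'S_p) \sum_(r : 'S_q)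
     F (block_perm t r * s)%g.
Proof.
pose h (str : 'S_(p + q) * ('S_p * 'S_q)) := (block_perm str.2.1 str.2.2 * str.1)%g.
pose D := [set str : 'S_(p + q) * ('S_p * 'S_q) | str.1 \in block_shuffles p (p + q)].
have h_inj : {in D &, injective h}.
  move=> [s1 [t1 r1]] [s2 [t2 r2]]; rewrite in_set => sh1.
  rewrite in_set => sh2; rewrite /h /= => eq_h.
  have e1 : s1 = (block_perm (t1^-1 * t2) (r1^-1 * r2) * s2)%g.
    by rewrite block_permM -block_permV -mulgA -eq_h mulKg.
  move: (sh1); rewrite e1 => /(block_shuffle_unique sh2)[te re].
  rewrite te re block_perm1 mul1g.
  by move/eqP: te; move/eqP: re; rewrite -!eq_mulVg1 => /eqP-> /eqP->.
have h_onto : h @: D = [set: 'S_(p + q)].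
  apply/setP => w; rewrite [RHS]inE; have [t [r sh]] := block_shuffle_exists w.
  apply/imsetP; exists ((block_perm t r * w)%g, (t^-1, r^-1)%g); first by rewrite in_set.
  by rewrite /h /= -block_permV mulKg.
transitivity (\sum_(w in h @: D) F w).
  by rewrite h_onto; apply: eq_bigl => w; rewrite inE.
rewrite big_imset //=; under [RHS]eq_bigr do rewrite pair_big /=.
rewrite pair_big_dep /=.
by apply: eq_bigl => -[s [t r]]; rewrite in_set andbT.
Qed.

(** * Expansion of the double commutator into signed words *)

(** Permutations are sorted by the preimage [i] of [ord_max]: the slot where the inner bracket, the
    last argument, lands in the outer product. *)
Lemma sum_lift_perm (V : nmodType) (q : nat) (G : 'S_q.+1 -> V) :
  \sum_s G s = \sum_i \sum_(t : 'S_q) G (lift_perm i ord_max t).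
Proof.
pose h (it : 'I_q.+1 * 'S_q) := lift_perm it.1 ord_max it.2.
have h_inj : injective h.
  move=> [i t] [j u] /permP; rewrite /h /= => eq_h.
  have eq_ij : i = j.
    apply: (@perm_inj _ (lift_perm j ord_max u)).
    by rewrite -eq_h !lift_perm_id.
  rewrite eq_ij in eq_h *; congr (_, _); apply/permP => k.
  by have := eq_h (lift j k); rewrite !lift_perm_lift => /lift_inj.
rewrite pair_big /= (reindex h) //; apply/onW_bij/inj_card_bij => //.
by rewrite card_prod !card_Sn card_ord factS.
Qed.

Lemma multilinear_sum (K : fieldType) (V : lmodType K) (n : nat)
    (w : n.-tuple V -> V) (I : Type) (e : seq I) (c : I -> K) (x : I -> V)
    (a : n.-tuple V) (i : 'I_n) :
    multilinear w ->
  w (tuple_set a i (\sum_(r <- e) c r *: x r)) =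
  \sum_(r <- e) c r *: w (tuple_set a i (x r)).
Proof.
move=> /(_ a i) w_lin; elim: e => [|r e IHe]; last by rewrite !big_cons w_lin IHe.
(* Linearity at -1, 0, 0 shows that the map sends 0 to 0. *)
by have := w_lin (-1) 0 0; rewrite !big_nil scaler0 addr0 scaleN1r addNr.
Qed.

Lemma nth_tuple_perm (V : nmodType) (m : nat) (a : m.-tuple V) (s : 'S_m) (k : 'I_m) :
  (tuple_perm a s)`_k = a`_(s k).
Proof. by rewrite -tnth_nth tnth_mktuple (tnth_nth 0). Qed.

Lemma tuple_permM (T : Type) (m : nat) (a : m.-tuple T) (s g : 'S_m) :
  tuple_perm (tuple_perm a s) g = tuple_perm a (g * s)%g.
Proof. by apply: eq_from_tnth => k; rewrite !tnth_mktuple permM. Qed.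

(* On words, this moves the last n letters to the positions i, ..., i + n - 1. *)
Definition block_move (p n i k : nat) : nat :=
  if (k < i)%N then k else if (k < i + n)%N then (p + (k - i))%N else (k - n)%N.

(** Starting from the identity at [i = p], each move of the block one place to the left is a cycle
    on the [n + 1] positions from [i] to [i + n], of parity [n]. *)
Lemma block_move_perm (p n i : nat) :
    (i <= p)%N ->
  exists2 c : 'S_(p + n), forall k, c k = block_move p n i k :> nat
    & c = odd (n * (p - i)) :> bool.
Proof.
have [d] : exists d, (p - i)%N = d by exists (p - i)%N.
elim: d i => [|d IHd] i eq_d le_ip.
  exists 1%g => [k|]; last by rewrite odd_perm1 eq_d muln0.
  by rewrite perm1 /block_move; have ? := ltn_ord k; do ?case: ltnP => ?; lia.
have [||c c_val c_odd] := IHd i.+1; [lia | lia |].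
have: (i + n < p + n)%N by lia.
(* [lift_perm] and [inord] need a size of the form [m.+1]. *)
move: (p + n)%N (erefl (p + n)%N) c c_val c_odd => [|m] // eq_m c c_val c_odd lt_in.
exists (lift_perm (inord (i + n)) (inord i) 1 * c)%g => [k|]; last first.
  rewrite odd_permM c_odd odd_lift_perm odd_perm1 !inordK; [|lia|lia].
  rewrite -(subnSK (m := i) (n := p)); last lia.
  by rewrite mulnS !oddD; case: (odd i); case: (odd n).
rewrite permM c_val; case: (unliftP (inord (i + n)) k) => [k'|] -> /=.
  by rewrite lift_perm_lift perm1 /= /bump !inordK /block_move; do ?case: ltnP => ?; lia.
by rewrite lift_perm_id !inordK /block_move; do ?case: ltnP => ?; lia.
Qed.

(* [nest] on sequences, so that the length can be written q + q.+1 instead of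
   2 * q.+1 - 1. *)
Definition nest_seq (K : fieldType) (V : lmodType K) (n : nat)
    (w : n.-tuple V -> V) (i : nat) (a : seq V) : V :=
  w [tuple if (k < i)%N then a`_k
           else if k == i :> nat then w [tuple a`_(i + j) | j < n]
           else a`_(k + n - 1) | k < n].

(** Here [t] orders the outer letters and [r] the inner ones, then [c i] carries the inner block to
    position [i]. The sign [(-1) ^+ (i + q)] is what [lift_perm i ord_max t] has beyond the sign of
    [t]. *)
Lemma nest_ncommutator (K : fieldType) (q : nat) (A : nAlgebra K q.+1)
    (a : (q + q.+1).-tuple A) (c : 'I_q.+1 -> 'S_(q + q.+1)) :
    (forall i k, c i k = block_move q q.+1 i k :> nat) ->
  nest_seq (@ncommutator K q.+1 A) q a =
  \sum_(i < q.+1) \sum_(t : 'S_q) \sum_(r : 'S_q.+1)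
     ((-1) ^+ (i + q) * (-1) ^+ block_perm t r)
       *: nest_seq (@nmul K q.+1 A) i (tuple_perm a (c i * block_perm t r)%g).
Proof.
move=> c_val; rewrite /nest_seq {1}/ncommutator sum_lift_perm.
apply: eq_bigr => i _; apply: eq_bigr => t _.
set T := (X in tuple_perm X); set U := tuple_perm T _.
(* Exhibiting the inner bracket as the entry in slot [i] makes multilinearity applicable. *)
have -> : U = tuple_set U i (\sum_(r : 'S_q.+1) (-1) ^+ r *:
             nmul (tuple_perm [tuple a`_(q + j) | j < q.+1] r)).
  apply: eq_from_tnth => k; rewrite [RHS]tnth_mktuple; case: eqP => // ->.
  by rewrite !tnth_mktuple lift_perm_id /= ltnn eqxx.
rewrite multilinear_sum; last exact: nmul_multilinear.
rewrite scaler_sumr; apply: eq_bigr => r _.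
rewrite scalerA sign_block_perm mulrA odd_lift_perm !signr_addb !signr_odd -exprD.
congr (_ *: _).
congr nmul; apply: eq_from_tnth => k; rewrite !tnth_mktuple.
have moved (x y : nat) (lt_x : (x < q + q.+1)%N) (z : 'I_(q + q.+1)) :
  z = block_move q q.+1 i x :> nat -> block_perm t r z = y :> nat ->
  a`_y = (tuple_perm a (c i * block_perm t r)%g)`_x.
  move=> z_val <-; rewrite -[x]/(val (Ordinal lt_x)) nth_tuple_perm permM.
  by congr (a`_(block_perm t r _)); apply: val_inj; rewrite /= z_val c_val.
have := ltn_ord k; have := ltn_ord i.
case: eqP => [->|neq_ki] lt_i lt_k.
  rewrite ltnn eqxx; congr nmul; apply: eq_from_tnth => j.
  rewrite !tnth_mktuple.
  apply: (moved _ _ _ (rshift q j)); rewrite ?block_permr //=.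
    by have := ltn_ord j; lia.
  by rewrite /block_move; have ? := ltn_ord j; do ?case: ltnP => ?; lia.
(* Outer letters: those before slot [i] keep their position in the word, those after it sit beyond
   the inner block. *)
case: (unliftP i k) lt_k neq_ki => [k'|] -> // lt_k _; have lt_k' := ltn_ord k'.
have lt_t := ltn_ord (t k').
rewrite lift_perm_lift /= /bump [(q <= t k')%N]leqNgt lt_t add0n lt_t.
have t_val : block_perm t r (lshift q.+1 k') = t k' :> nat by rewrite block_perml.
case: (leqP i k') => le_i /=; last first.
  rewrite add0n le_i; apply: moved t_val; first exact: ltn_addr.
  by rewrite /block_move le_i.
rewrite add1n ltnNge (leq_trans le_i) //= gtn_eqF //.
rewrite /= in lt_k' le_i *; apply: moved t_val; first by lia.
by rewrite /block_move /=; do ?case: ltnP => ?; lia.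
Qed.

(** * Total associativity and cancellation of signs *)

Lemma nest_seqE (K : fieldType) (q : nat) (A : nAlgebra K q.+1) (i : nat)
    (a : (q + q.+1).-tuple A) :
    total_associative A -> (i <= q)%N ->
  nest_seq (@nmul K q.+1 A) i a = nest_seq (@nmul K q.+1 A) 0 a.
Proof.
move=> A_assoc; elim: i => // i IHi lt_iq; rewrite -IHi ?(ltnW lt_iq) //.
have size_a : size a == (2 * q.+1 - 1)%N by rewrite size_tuple; lia.
by apply/esym/(A_assoc i (Tuple size_a)); lia.
Qed.

Lemma sum_signr (R : pzRingType) (k : nat) :
  \sum_(i < k) (-1) ^+ i = (odd k)%:R :> R.
Proof.
elim: k => [|k IHk]; first by rewrite big_ord0.
by rewrite big_ord_recr /= IHk -signr_odd; case: odd; rewrite ?subrr ?add0r.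
Qed.

(** The two factors are the signs from [lift_perm] and from [block_move_perm]. For odd [q.+1] they
    cancel, leaving [q.+1] terms 1; for even [q.+1] the second is 1 and the first alternates. *)
Lemma sum_insertion_signs (K : fieldType) (q : nat) :
    ~~ odd q.+1 \/ (exists2 p : nat, p \in [pchar K] & (p %| q.+1)%N) ->
  \sum_(i < q.+1) (-1) ^+ (i + q) * (-1) ^+ (q.+1 * (q - i)) = 0 :> K.
Proof.
case: (boolP (odd q.+1)) => [odd_n [//|[p charp p_dvd]]|even_n _].
  rewrite (eq_bigr (fun=> 1)) => [|i _].
    by rewrite sumr_const card_ord; apply/eqP; rewrite -(dvdn_pcharf charp).
  rewrite -exprD -signr_odd !oddD oddM oddB ?leq_ord //=.
  by move: odd_n => /=; case: (odd i); case: (odd q).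
rewrite (eq_bigr (fun i : 'I_q.+1 => (-1) ^+ q * (-1) ^+ i)) => [|i _].
  by rewrite -mulr_sumr sum_signr (negbTE even_n) mulr0.
by rewrite -[X in _ * X]signr_odd oddM (negbTE even_n) mulr1 addnC exprD.
Qed.

Lemma sum_block_shuffles_nest (K : fieldType) (q : nat) (A : nAlgebra K q.+1)
    (b : (q + q.+1).-tuple A) :
    total_associative A ->
    ~~ odd q.+1 \/ (exists2 p : nat, p \in [pchar K] & (p %| q.+1)%N) ->
  \sum_(s in block_shuffles q (q + q.+1))
     (-1) ^+ s *: nest_seq (@ncommutator K q.+1 A) q (tuple_perm b s) = 0.
Proof.
move=> A_assoc n_even_or_char.
have /fin_all_exists2[c c_val c_odd] (i : 'I_q.+1) :=
  @block_move_perm q q.+1 i (leq_ord i).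
pose F w : A := nest_seq (@nmul K q.+1 A) 0 (tuple_perm b w).
under eq_bigr => s _.
  rewrite (nest_ncommutator _ c_val) scaler_sumr.
  under eq_bigr => i _.
    rewrite scaler_sumr.
    under eq_bigr => t _.
      rewrite scaler_sumr.
      under eq_bigr => r _.
        rewrite nest_seqE ?leq_ord // tuple_permM -mulgA scalerA mulrCA -scalerA.
        rewrite [_ ^+ s * _]mulrC -signr_addb -odd_permM -/(F _).
        over.
      over.
    over.
  over.
(* The right-hand 0 becomes the vanishing sum of insertion signs times the signed sum of all words,
   to be compared slot by slot. *)
rewrite exchange_big /= -[RHS](scale0r (\sum_(w : 'S_(q + q.+1)) (-1) ^+ w *: F w)).
rewrite -(sum_insertion_signs n_even_or_char) scaler_suml; apply: eq_bigr => i _.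
rewrite -(sum_block_shuffles (fun w : 'S_(q + q.+1) =>
  (-1) ^+ (i + q) *: ((-1) ^+ w *: F (c i * w)%g))) /=.
rewrite -scaler_sumr -scalerA; congr (_ *: _).
(* Translation by [c i] contributes its sign, which cancels the second insertion sign. *)
rewrite [in RHS](reindex_inj (mulgI (c i))) scaler_sumr; apply: eq_bigr => w _.
rewrite scalerA -[_ ^+ (_ * _)]signr_odd -c_odd odd_permM signr_addb mulrA.
by rewrite -expr2 sqrr_sign mul1r.
Qed.

Theorem theorem1p1 (K : fieldType) (n : nat) (A : nAlgebra K n)
    (n_ge2 : (2 <= n)%N) (A_assoc : total_associative A)
    (n_even_or_char : ~~ odd n \/ (exists2 p : nat, p \in [pchar K] & (p %| n)%N)) :
  homotopical_nLie (commutator_algebra A).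
Proof.
case: n A n_ge2 A_assoc n_even_or_char => // q A _ A_assoc n_even_or_char.
(* With [m] and [p] as variables, the length [2 * q.+1 - 1] is replaced by [q + q.+1] without
   casting tuples or permutations. *)
have core (m p : nat) (b : m.-tuple A) : m = (q + q.+1)%N -> p = q ->
    \sum_(s in block_shuffles p m)
       (-1) ^+ s *: nest_seq (@ncommutator K q.+1 A) p (tuple_perm b s) = 0.
  by move=> eq_m eq_p; subst m p; apply: sum_block_shuffles_nest.
by move=> b; apply: (core _ _ b); lia.
Qed.
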